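(* Let $n \ge m$ and let $X \in \mathbb{R}^{n\times m}$ be an orthogonal design, i.e. $X^\top X = I_m$. Suppose $y = X\beta + \epsilon$ with unknown $\beta \in \mathbb{R}^m$ and noise $\epsilon \sim N(0,\sigma^2 I_n)$ with known $\sigma>0$. Fix $\alpha,\gamma\in(0,1)$ and define, for $i=1,\dots,m$, $$\lambda_{\mathrm{FDP}}(i)=\Phi^{-1}\!\left(1-\frac{(\lfloor \gamma i\rfloor+1)\,\alpha}{2\,(m+\lfloor\gamma i\rfloor+1-i)}\right).$$ Let $\hat\beta$ be the F-SLOPE estimator $$\hat\beta \in \arg\min_{b\in\mathbb{R}^m}\ \frac12\|y-Xb\|_2^2+\sigma\sum_{i=1}^m \lambda_{\mathrm{FDP}}(i)\,|b|_{(i)}.$$ Let $R$ be the number of indices $i$ with $\hat\beta_i\neq0$, let $V$ be the number of indices $i$ with $\beta_i=0$ but $\hat\beta_i\neq 0$, and let $\mathrm{FDP}=V/\max\{R,1\}$. Then $$\mathrm{Prob}\{\mathrm{FDP}>\gamma\}\le\alpha.$$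
   Context: $\Phi$ denotes the cumulative distribution function of the standard normal distribution and $\Phi^{-1}$ its inverse; $\lfloor\cdot\rfloor$ is the floor function. For $b\in\mathbb{R}^m$, $|b|_{(1)}\ge |b|_{(2)}\ge\cdots\ge |b|_{(m)}$ denote the absolute values of the entries of $b$ sorted in non-increasing order. Feature $i$ is ''selected'' (the null hypothesis $H_i:\beta_i=0$ is rejected) when $\hat\beta_i\neq 0$. *)

(* Defs.v *)
From HB Require Import structures.
From mathcomp Require Import all_boot all_order all_algebra.
From mathcomp Require Import all_classical all_reals all_analysis.
Set Implicit Arguments. Unset Strict Implicit. Unset Printing Implicit Defensive.
Import Order.TTheory GRing.Theory Num.Theory.
Local Open Scope classical_set_scope.
Local Open Scope ring_scope.

Section Defs.
Variable R : realType.

Definition Phi (x : R) : R := fine (normal_prob (0:R) 1 `]-oo, x]).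

(* its inverse (quantile function); Phi is a continuous increasing bijection
   R -> (0,1), so this is the usual Phi^{-1} on (0,1) *)
Definition Phi_inv (p : R) : R := inf [set x : R | p <= Phi x].

(* lambda_FDP(i) for 1-indexed i = (val i).+1 *)
Definition lambda_FDP (m : nat) (alpha gamma : R) (i : 'I_m) : R :=
  let k : R := (val i).+1%:R in
  let f : R := (Num.floor (gamma * k))%:~R in
  Phi_inv (1 - (f + 1) * alpha / (2 * (m%:R + f + 1 - k))).

Definition abs_sorted (m : nat) (b : 'cV[R]_m) : seq R :=
  sort (fun x y : R => y <= x) [seq `|b j 0| | j <- enum 'I_m].

Definition slope_obj (n m : nat) (X : 'M[R]_(n, m)) (y : 'cV[R]_n)
  (sigma : R) (lam : 'I_m -> R) (b : 'cV[R]_m) : R :=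
  2^-1 * (\sum_(j < n) ((y - X *m b) j 0) ^+ 2)
  + sigma * \sum_(i < m) lam i * nth 0 (abs_sorted b) i.

Definition mutually_independent d (T : measurableType d) (P : probability T R)
  (n : nat) (eps : 'I_n -> T -> R) : Prop :=
  forall B : 'I_n -> set R, (forall i, measurable (B i)) ->
    P (\bigcap_(i in [set: 'I_n]) (eps i @^-1` B i)) =
    (\prod_(i < n) P (eps i @^-1` B i))%E.

Definition num_selected (m : nat) (bh : 'cV[R]_m) : nat :=
  #|[set i : 'I_m | bh i 0 != 0]|.

Definition num_false (m : nat) (beta bh : 'cV[R]_m) : nat :=
  #|[set i : 'I_m | (beta i 0 == 0) && (bh i 0 != 0)]|.

Definition FDP (m : nat) (beta bh : 'cV[R]_m) : R :=
  (num_false beta bh)%:R / (maxn (num_selected bh) 1)%:R.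

End Defs.
Arguments Phi {R}.
Arguments Phi_inv {R}.
Arguments lambda_FDP {R}.

(* Main.v *)
Require Import Defs.
From HB Require Import structures.
From mathcomp Require Import all_boot all_order all_algebra.
From mathcomp Require Import all_classical all_reals all_analysis.
From mathcomp Require Import fingroup perm measurable_realfun ring lra.
Import Order.TTheory GRing.Theory Num.Theory.
Local Open Scope classical_set_scope.
Local Open Scope ring_scope.

(* Put z = X^T y = beta + X^T eps, and let n0 be the number of nulls. If the
   minimiser selects r features, shrinking one selected coordinate i shows
   |z_i| > sigma * lambda(r). So when V > gamma * r of them are null, V null
   p-values lie below (floor(gamma r) + 1) alpha / (m + floor(gamma r) + 1 - r),
   which is at most V alpha / n0 because floor(gamma r) + 1 <= V and
   n0 <= m - r + V. By Simes' inequality for independent p-values this has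
   probability at most alpha.
   The coordinates of X^T eps are, up to sign, iid N(0, sigma^2): Givens
   rotations turn the rows of X^T into signed unit vectors, and a planar rotation
   is a product of shears, which preserve Lebesgue measure by Fubini. The event is
   measurable because the minimiser is a Lipschitz function of z. *)

(** * The sorted l1 norm and its proximal map *)

(** Optimality of the estimator enters the probabilistic bound only through one necessary condition
    on each selected coordinate. Simes' inequality is then applied to the null coordinates alone, at
    the random index [V], so neither the non-null means nor the coupling inside the estimator
    matters. Simes' argument conditions on all p-values but one. Only [n0] thresholds are ever
    compared, so each coordinate is replaced by a level in a finite set; independence becomes a
    product weight and the conditioning a rearrangement of finite sums. Independence of the noise is
    given on boxes, and a rotated box is no box. Rotating two coordinates at a time confines this
    obstacle to the plane, where uniqueness of product measures passes from rectangles to all Borel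
    sets. *)

Lemma rearrangement (R : realFieldType) (m : nat) (a : 'I_m -> R) (c : nat -> R)
    (p : 'S_m) :
  (forall i j : 'I_m, (i <= j)%N -> a j <= a i) ->
  (forall k, c k.+1 <= c k) ->
  \sum_i a i * c (p i) <= \sum_i a i * c i.
Proof.
move=> a_ni c_ni.
(* Abel summation: [c] is a constant plus a nonnegative combination of indicators of initial
   segments. *)
have cE (i : 'I_m) :
    c i = c m + \sum_(k < m) (c k - c k.+1) * ((i <= k)%N)%:R.
  rewrite -(big_mkord xpredT (fun k => (c k - c k.+1) * ((i <= k)%N)%:R)).
  rewrite (big_cat_nat (leq0n i) (ltnW (ltn_ord i)))/=.
  rewrite big_nat_cond big1 ?add0r; last first.
    by move=> k /andP[/andP[_ ki] _]; rewrite leqNgt ki mulr0.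
  rewrite big_nat_cond (eq_bigr (fun k => c k - c k.+1)); last first.
    by move=> k /andP[/andP[ik _] _]; rewrite ik mulr1.
  rewrite -big_nat_cond.
  have -> : \sum_(i <= k < m) (c k - c k.+1) = c i - c m.
    rewrite -[RHS]opprB -(telescope_sumr c (ltnW (ltn_ord i))) -sumrN.
    by apply: eq_bigr => k _; rewrite opprB.
  by ring.
rewrite -subr_ge0 -sumrB.
(* Subtracting [a k] is free, since [p] is a bijection and the bracket sums to zero over [i].
   Afterwards both factors are nonnegative for [i <= k] and nonpositive for [k < i]. *)
have -> : \sum_i (a i * c i - a i * c (p i)) =
    \sum_(k < m) (c k - c k.+1) *
      \sum_i (a i - a k) * (((i <= k)%N)%:R - ((p i <= k)%N)%:R).
  transitivity (\sum_(k < m) (c k - c k.+1) *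
      \sum_i a i * (((i <= k)%N)%:R - ((p i <= k)%N)%:R)).
    under [RHS]eq_bigr do rewrite mulr_sumr.
    rewrite exchange_big/=; apply: eq_bigr => i _.
    rewrite (cE i) (cE (p i)) -mulrBr opprD addrACA subrr add0r -sumrB mulr_sumr.
    by apply: eq_bigr => k _; ring.
  apply: eq_bigr => k _; congr (_ * _).
  under [RHS]eq_bigr do rewrite mulrBl.
  rewrite sumrB -[LHS]subr0; congr (_ - _).
  by rewrite -mulr_sumr sumrB [X in _ - X](reindex_inj (@perm_inj _ p^-1)%g)/=;
     under [X in _ - X]eq_bigr do rewrite permKV; rewrite subrr mulr0.
apply: sumr_ge0 => k _; apply: mulr_ge0; first by rewrite subr_ge0.
apply: sumr_ge0 => i _.
have [ik|ki] := leqP i k.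
  apply: mulr_ge0; first by rewrite subr_ge0 a_ni.
  by case: leqP; rewrite ?subrr ?subr0.
have ? : a i <= a k by rewrite a_ni// ltnW.
by apply: mulr_le0; [lra|case: leqP => _; rewrite ?subr0// sub0r lerN10].
Qed.

Lemma num_selectedE (R : realType) (m : nat) (b : 'cV[R]_m) :
  num_selected b = #|[pred i | b i 0 != 0]|.
Proof. by apply: eq_card => i; apply/idP/idP => [/set_mem|/mem_set]. Qed.

Lemma num_falseE (R : realType) (m : nat) (beta b : 'cV[R]_m) :
  num_false beta b = #|[pred i | (beta i 0 == 0) && (b i 0 != 0)]|.
Proof. by apply: eq_card => i; apply/idP/idP => [/set_mem|/mem_set]. Qed.

Section SortedNorm.
Context {R : realType} {m : nat} (lam : 'I_m -> R).
Hypothesis lam_ni : forall i j : 'I_m, (i <= j)%N -> lam j <= lam i.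
Implicit Types b z y : 'cV[R]_m.

Definition sorted_norm b : R := \sum_(i < m) lam i * nth 0 (abs_sorted b) i.

Lemma abs_sorted_perm b :
  exists p : 'S_m, forall i : 'I_m, nth 0 (abs_sorted b) i = `|b (p i) 0|.
Proof.
pose t := [tuple `|b j 0| | j < m].
have : perm_eq (abs_sorted b) t.
  by rewrite /abs_sorted perm_sort /t /= ?enumT ?val_ord_tuple; exact: perm_refl.
move=> /tuple_permP[p pE]; exists p => i.
by rewrite pE (nth_map i) ?size_enum_ord// nth_ord_enum tnth_mktuple.
Qed.

Lemma size_abs_sorted b : size (abs_sorted b) = m.
Proof. by rewrite /abs_sorted size_sort size_map size_enum_ord. Qed.

Lemma abs_sorted_ge0 b k : 0 <= nth 0 (abs_sorted b) k.
Proof.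
have [km|mk] := ltnP k m; last by rewrite nth_default ?size_abs_sorted.
by have [p /(_ (Ordinal km))/= ->] := abs_sorted_perm b.
Qed.

(** The default [0] of [nth] lies below every absolute value, so monotonicity persists past the end,
    as [rearrangement] requires of [c]. *)
Lemma abs_sorted_ni b k l : (k <= l)%N ->
  nth 0 (abs_sorted b) l <= nth 0 (abs_sorted b) k.
Proof.
move=> kl; have [lm|ml] := ltnP l m; last first.
  by rewrite nth_default ?size_abs_sorted// abs_sorted_ge0.
have ge_trans : transitive (fun x y : R => y <= x).
  by move=> x y z xy zx; exact: le_trans zx xy.
have s : sorted (fun x y : R => y <= x) (abs_sorted b).
  by apply: sort_sorted => x y; exact: le_total.
apply: (sorted_leq_nth ge_trans _ 0 s) => //=;
  by rewrite inE size_abs_sorted ?(leq_ltn_trans kl).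
Qed.

(** With [sorted_norm_perm] this presents the norm as a maximum over permutations. Convexity and the
    effect of shrinking a coordinate then follow by freezing the optimal permutation of one
    vector. *)
Lemma perm_le_sorted_norm b (p : 'S_m) :
  \sum_i lam i * `|b (p i) 0| <= sorted_norm b.
Proof.
have [q qE] := abs_sorted_perm b.
have qVE i : `|b i 0| = nth 0 (abs_sorted b) ((q^-1)%g i) by rewrite qE permKV.
under eq_bigr do rewrite qVE -permM.
by apply: rearrangement => // k; exact: abs_sorted_ni.
Qed.

Lemma sorted_norm_perm b : exists p : 'S_m,
  sorted_norm b = \sum_i lam i * `|b (p i) 0|.
Proof.
have [p pE] := abs_sorted_perm b; exists p.
by apply: eq_bigr => i _; rewrite pE.
Qed.

Lemma sorted_norm_midpoint b z : (forall i, 0 <= lam i) ->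
  sorted_norm (2^-1 *: (b + z)) <= 2^-1 * (sorted_norm b + sorted_norm z).
Proof.
move=> lam0; have [p ->] := sorted_norm_perm (2^-1 *: (b + z)).
apply: le_trans (_ : _ <= 2^-1 * (\sum_i lam i * `|b (p i) 0| +
    \sum_i lam i * `|z (p i) 0|)) _; last first.
  by rewrite ler_pM2l ?invr_gt0// lerD ?perm_le_sorted_norm.
rewrite -big_split/= mulr_sumr; apply: ler_sum => i _.
rewrite !mxE normrM ger0_norm ?invr_ge0// mulrCA ler_pM2l ?invr_gt0//.
by rewrite -mulrDr ler_wpM2l// ler_normD.
Qed.

(** Evaluate [b] along the order of [z]: only the term of [i] changes, by [h] times the weight at
    its rank [l] in [z]. Everything ranked up to [l] is non-zero in [z], hence in [b], so [l <= j]
    and that weight is at least [lam j]. *)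
Lemma sorted_norm_shrink b z (h : R) (i : 'I_m) (j : 'I_m) :
  0 <= h < `|b i 0| -> `|z i 0| = `|b i 0| - h ->
  (forall k, k != i -> z k 0 = b k 0) ->
  (num_selected b <= j.+1)%N ->
  sorted_norm z + h * lam j <= sorted_norm b.
Proof.
move=> /andP[h0 hb] zi zE bj.
have [q qE] := abs_sorted_perm z.
have -> : sorted_norm z = \sum_k lam k * `|z (q k) 0|.
  by apply: eq_bigr => k _; rewrite qE.
apply: le_trans (perm_le_sorted_norm b q).
pose l := (q^-1)%g i.
have lj : (l <= j)%N.
  rewrite -ltnS; apply: leq_trans bj.
  pose A := [set q k | k in [set k : 'I_m | (k <= l)%N]]%SET.
  have -> : l.+1 = #|A|.
    rewrite card_imset; last exact: perm_inj.
    rewrite -sum1_card (eq_bigl (fun k : 'I_m => (k < l.+1)%N)); last first.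
      by move=> k; rewrite inE ltnS.
    by rewrite (big_ord_narrow (ltn_ord l)) sum_nat_const card_ord muln1.
  rewrite num_selectedE.
  apply: subset_leq_card; apply/fintype.subsetP => _ /imsetP[k + ->].
  rewrite !inE => kl.
  have : 0 < `|z (q k) 0|.
    rewrite -qE; apply: lt_le_trans (abs_sorted_ni z k l kl).
    by rewrite qE /l permKV zi subr_gt0.
  rewrite normr_gt0; have [->|/zE -> //] := eqVneq (q k) i.
  by move=> _; rewrite -normr_gt0; exact: le_lt_trans hb.
rewrite (bigD1 l)//= [leRHS](bigD1 l)//= /l permKV zi.
rewrite [X in _ + X + _](eq_bigr (fun k => lam k * `|b (q k) 0|)); last first.
  by move=> k kl; rewrite zE//; apply: contraNneq kl => <-; rewrite permK.
have := ler_wpM2l h0 (lam_ni _ _ lj); rewrite /l; lra.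
Qed.

Variable sigma : R.
Hypothesis sigma_gt0 : 0 < sigma.

Definition prox_obj y b :=
  2^-1 * (\sum_j (y j 0 - b j 0) ^+ 2) + sigma * sorted_norm b.

Lemma prox_selected y b (i j : 'I_m) :
  (forall z, prox_obj y b <= prox_obj y z) ->
  b i 0 != 0 -> (num_selected b <= j.+1)%N ->
  sigma * lam j < `|y i 0|.
Proof.
move=> bmin bi bj.
(* Halving keeps the coordinate non-zero, as [sorted_norm_shrink] demands, and leaves a positive
   multiple of [b i 0 ^+ 2] to spare, whence the strict inequality. *)
pose z := \col_k (if k == i then 2^-1 * b i 0 else b k 0).
have zi : z i 0 = 2^-1 * b i 0 by rewrite mxE eqxx.
have zk k : k != i -> z k 0 = b k 0 by move=> ki; rewrite mxE (negbTE ki).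
have bi0 : 0 < `|b i 0| by rewrite normr_gt0.
have J : sorted_norm z + 2^-1 * `|b i 0| * lam j <= sorted_norm b.
  apply: (@sorted_norm_shrink b z _ i) => //; first by apply/andP; split; lra.
  by rewrite zi normrM ger0_norm; lra.
have := bmin z; rewrite /prox_obj (bigD1 i)//= [X in _ <= _ * X + _](bigD1 i)//= zi.
rewrite [X in _ <= _ * (_ + X) + _](eq_bigr (fun k => (y k 0 - b k 0) ^+ 2)); last first.
  by move=> k ki; rewrite zk.
have := ler_wpM2l (ltW sigma_gt0) J.
have yb : y i 0 * b i 0 <= `|y i 0| * `|b i 0| by rewrite -normrM ler_norm.
have b2 : `|b i 0| * `|b i 0| = b i 0 * b i 0.
  by rewrite -normrM ger0_norm// -expr2 sqr_ge0.
set S := \sum_(_ < _ | _) _; move=> h1 h2.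
rewrite -(ltr_pM2r bi0).
have : 0 < `|b i 0| * `|b i 0| by exact: mulr_gt0.
set B := `|b i 0| in yb b2 bi0 h1 h2 *; set Y := `|_| in yb *.
move: h1 h2 yb b2; rewrite !expr2.
set u := y i 0; set v := b i 0; set Jb := sorted_norm b; set Jz := sorted_norm z.
move=> h1 h2 yb b2 ?; lra.
Qed.

(** Both minimisers are compared with their midpoint. The norms drop out by convexity and strong
    convexity of the squares leaves the left-hand side. The midpoint costs a factor 2, harmless for
    continuity. *)
Lemma prox_lipschitz y y' b b' : (forall i, 0 <= lam i) ->
  (forall z, prox_obj y b <= prox_obj y z) ->
  (forall z, prox_obj y' b' <= prox_obj y' z) ->
  \sum_j (b j 0 - b' j 0) ^+ 2 <=
    2 * \sum_j (y j 0 - y' j 0) * (b j 0 - b' j 0).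
Proof.
move=> lam0 bmin bmin'; pose z := 2^-1 *: (b + b').
have J := ler_wpM2l (ltW sigma_gt0) (sorted_norm_midpoint b b' lam0).
have := bmin z; have := bmin' z; rewrite /prox_obj.
have E : 2^-1 * (\sum_j (y j 0 - z j 0) ^+ 2) + 2^-1 * (\sum_j (y' j 0 - z j 0) ^+ 2)
   = 2^-1 * (\sum_j (y j 0 - b j 0) ^+ 2) + 2^-1 * (\sum_j (y' j 0 - b' j 0) ^+ 2)
     + 2^-1 * \sum_j (y j 0 - y' j 0) * (b j 0 - b' j 0)
     - 4^-1 * \sum_j (b j 0 - b' j 0) ^+ 2.
  rewrite !mulr_sumr -!big_split/= -sumrB; apply: eq_bigr => j _.
  by rewrite !mxE; field.
rewrite -/z in J *; lra.
Qed.

Lemma prox_continuous y y' b b' (e : R) : (forall i, 0 <= lam i) ->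
  (forall z, prox_obj y b <= prox_obj y z) ->
  (forall z, prox_obj y' b' <= prox_obj y' z) ->
  (forall j, `|y j 0 - y' j 0| <= e) ->
  forall i, (b i 0 - b' i 0) ^+ 2 <= 4 * m%:R * e ^+ 2.
Proof.
move=> lam0 bmin bmin' ye i.
have := prox_lipschitz y y' b b' lam0 bmin bmin'.
have : 2 * \sum_j (y j 0 - y' j 0) * (b j 0 - b' j 0) <=
    2^-1 * \sum_j (b j 0 - b' j 0) ^+ 2 + 2 * m%:R * e ^+ 2.
  have -> : 2 * m%:R * e ^+ 2 = \sum_(j < m) 2 * e ^+ 2.
    by rewrite sumr_const card_ord -mulr_natl; ring.
  rewrite !mulr_sumr -big_split/=; apply: ler_sum => j _.
  have h : (y j 0 - y' j 0) ^+ 2 <= e ^+ 2.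
    by rewrite -real_normK ?num_real// lerXn2r ?nnegrE// (le_trans _ (ye j)).
  (* AM-GM weighted so that half of the square of [b - b'] remains to be absorbed. *)
  have := sqr_ge0 (2^-1 * (b j 0 - b' j 0) - (y j 0 - y' j 0)).
  move: h; rewrite !expr2; lra.
have : (b i 0 - b' i 0) ^+ 2 <= \sum_j (b j 0 - b' j 0) ^+ 2.
  by rewrite (bigD1 i)//= lerDl sumr_ge0// => j _; exact: sqr_ge0.
lra.
Qed.

End SortedNorm.

(** Pythagoras: [K] is half the squared distance from [y] to the column span of [X]. *)
Lemma slope_obj_orthogonal (R : realType) (n m : nat) (X : 'M[R]_(n, m))
    (y : 'cV[R]_n) (sigma : R) (lam : 'I_m -> R) : X^T *m X = 1%:M ->
  exists K, forall b, slope_obj X y sigma lam b = K + prox_obj lam sigma (X^T *m y) b.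
Proof.
move=> XX.
have sqE k (v : 'cV[R]_k) : \sum_j (v j 0) ^+ 2 = (v^T *m v) 0 0.
  by rewrite mxE; apply: eq_bigr => j _; rewrite mxE expr2.
exists (2^-1 * (y^T *m y - (X^T *m y)^T *m (X^T *m y)) 0 0) => b.
rewrite /slope_obj /prox_obj addrA; congr (_ + _); rewrite -mulrDr; congr (_ * _).
have -> : \sum_j ((X^T *m y) j 0 - b j 0) ^+ 2 = \sum_j ((X^T *m y - b) j 0) ^+ 2.
  by apply: eq_bigr => j _; rewrite !mxE.
rewrite !sqE.
set Y := X^T *m y.
have XbXb : (X *m b)^T *m (X *m b) = b^T *m b.
  by rewrite trmx_mul -mulmxA [X in _ *m X]mulmxA XX mul1mx.
have yXb : y^T *m (X *m b) = Y^T *m b by rewrite /Y trmx_mul trmxK mulmxA.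
have Xby : (X *m b)^T *m y = b^T *m Y by rewrite trmx_mul mulmxA.
rewrite [(y - _)^T]linearB [(Y - _)^T]linearB/= !(mulmxBl, mulmxBr) XbXb yXb Xby.
by rewrite !mxE; ring.
Qed.

(** * Simes' inequality for product weights *)

Section FinUpd.
Context {I : finType} {q : nat}.
Local Notation K := {ffun I -> 'I_q.+1}.
Implicit Types (k : K).

Definition fupd k (i : I) (l : 'I_q.+1) : {ffun I -> 'I_q.+1} :=
  [ffun j => if j == i then l else k j].

Lemma fupd_eq k i l : fupd k i l i = l. Proof. by rewrite ffunE eqxx. Qed.

Lemma fupd_neq k i l j : j != i -> fupd k i l j = k j.
Proof. by rewrite ffunE => /negbTE ->. Qed.

Lemma fupd_fupd k i l l' : fupd (fupd k i l) i l' = fupd k i l'.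
Proof. by apply/ffunP => j; rewrite !ffunE; case: eqP. Qed.

Lemma fupd_id k i : fupd k i (k i) = k.
Proof. by apply/ffunP => j; rewrite !ffunE; case: eqP => // ->. Qed.

Variables (R : comPzRingType) (w : I -> 'I_q.+1 -> R).

(** Functions agreeing off [i] form a class, represented by its member with value [ord0] at [i]. *)
Lemma sum_ffun_split (i : I) (F : {ffun I -> 'I_q.+1} -> R) :
  \sum_(k : K) F k = \sum_(k : K | fupd k i ord0 == k) \sum_l F (fupd k i l).
Proof.
rewrite pair_big/=.
rewrite (reindex_onto (fun p : _ * 'I_q.+1 => fupd p.1 i p.2)
  (fun k => (fupd k i ord0, k i)))/=; last by move=> k _; rewrite fupd_fupd fupd_id.
by apply: eq_bigl => -[k l]/=; rewrite fupd_fupd fupd_eq xpair_eqE eqxx !andbT.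
Qed.

(* Independence of the coordinate [i] from the others under the product weight. *)
Lemma sum_ffun_decouple (i : I) (f : 'I_q.+1 -> R) (g : {ffun I -> 'I_q.+1} -> R) :
  \sum_l w i l = 1 ->
  \sum_(k : K) f (k i) * g (fupd k i ord0) * \prod_j w j (k j) =
  (\sum_l f l * w i l) * \sum_(k : K) g (fupd k i ord0) * \prod_j w j (k j).
Proof.
move=> w1.
have E (f' : 'I_q.+1 -> R) :
    \sum_(k : K) f' (k i) * g (fupd k i ord0) * \prod_j w j (k j) =
    (\sum_l f' l * w i l) *
    \sum_(k : K | fupd k i ord0 == k) g k * \prod_(j | j != i) w j (k j).
  rewrite (sum_ffun_split i) mulr_sumr; apply: eq_bigr => k /eqP k0.
  rewrite mulr_suml; apply: eq_bigr => l _.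
  rewrite fupd_eq fupd_fupd k0 (bigD1 i)//= fupd_eq.
  rewrite (eq_bigr (fun j => w j (k j))); first by ring.
  by move=> j ji; rewrite fupd_neq.
rewrite (E f); congr (_ * _).
transitivity (\sum_(k : K) 1 * g (fupd k i ord0) * \prod_j w j (k j)).
  by rewrite (E (fun=> 1))/= -mulr_sumr w1 !mul1r.
by apply: eq_bigr => k _; rewrite mul1r.
Qed.

End FinUpd.

Section Simes.
Context {R : realFieldType} {I : finType} {q : nat}.
Variables (w : I -> 'I_q.+1 -> R) (N : {set I}) (alpha : R).
Local Notation K := {ffun I -> 'I_q.+1}.
Implicit Types (k : K).

(** [k i < t] stands for the p-value of [i] falling below [t * alpha / #|N|]; compare [w_tail]. *)
Definition count_below k (t : nat) := #|[pred i in N | (k i < t)%N]|.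

Definition simes_reject k (t : nat) := (0 < t)%N && (t <= count_below k t)%N.

(** The largest rejecting threshold cuts the rejection event into disjoint pieces. *)
Let last_reject k (t : 'I_#|N|.+1) :=
  simes_reject k t && [forall s : 'I_#|N|.+1, (t < s)%N ==> ~~ simes_reject k s].

Let count_below_fupd k i (t s : nat) : (k i < t)%N -> (t <= s)%N ->
  count_below (fupd k i ord0) s = count_below k s.
Proof.
move=> kt ts; apply: eq_card => j; rewrite !inE; congr (_ && _).
have [->|ji] := eqVneq j i; last by rewrite fupd_neq.
by rewrite fupd_eq (leq_trans kt ts) (leq_trans _ ts)// (leq_ltn_trans _ kt).
Qed.

(** Leave-one-out: lowering [k i] further changes no count at [t] or above, so on [k i < t] the
    event depends on the other coordinates only. *)
Let last_reject_fupd k i (t : 'I_#|N|.+1) : (k i < t)%N ->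
  last_reject (fupd k i ord0) t = last_reject k t.
Proof.
move=> kt; rewrite /last_reject /simes_reject (count_below_fupd _ _ t)//.
congr (_ && _); apply: eq_forallb => s; case: (ltnP t s) => //= ts.
by rewrite (count_below_fupd _ _ t)// ltnW.
Qed.

Let count_below_max k t : (count_below k t <= #|N|)%N.
Proof.
by apply: subset_leq_card; apply/fintype.subsetP => i; rewrite !inE => /andP[].
Qed.

(** A larger count would make [t.+1] reject too, against maximality. *)
Let last_reject_count k t : last_reject k t -> count_below k t = t.
Proof.
move=> /andP[/andP[t0 tc] /forallP ht]; apply/eqP; rewrite eqn_leq tc andbT.
have [tN|] := ltnP t #|N|; last exact: leq_trans (count_below_max k t).
have /implyP/(_ (ltnSn _)) := ht (Ordinal (tN : (t.+1 < #|N|.+1)%N)).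
rewrite /simes_reject/= -ltnNge ltnS; apply: leq_trans.
apply: subset_leq_card; apply/fintype.subsetP => i; rewrite !inE => /andP[->]/=.
by move=> /ltn_trans; apply.
Qed.

Let last_reject_exists k (t : 'I_#|N|.+1) : simes_reject k t ->
  exists s, last_reject k s.
Proof.
move=> kt.
case: (@arg_maxnP _ t (simes_reject k) val kt) => s ks smax; exists s.
rewrite /last_reject ks; apply/forallP => s'; apply/implyP => ss'.
by apply/negP => /smax /= s's; rewrite ltnNge s's in ss'.
Qed.

Let last_reject_uniq k s t : last_reject k s -> last_reject k t -> s = t.
Proof.
move=> /andP[ks /forallP hs] /andP[kt /forallP ht]; apply/val_inj => /=.
case: (ltngtP s t) => // st.
  by move/implyP: (hs t) => /(_ st)/negP; case.
by move/implyP: (ht s) => /(_ st)/negP; case.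
Qed.

Hypothesis w_ge0 : forall i l, 0 <= w i l.
Hypothesis w_sum1 : forall i, \sum_l w i l = 1.
Hypothesis alpha_ge0 : 0 <= alpha.
Hypothesis w_tail : forall i t, i \in N -> (0 < t <= #|N|)%N ->
  \sum_(l < q.+1 | (l < t)%N) w i l <= t%:R * alpha / #|N|%:R.

Let prod_ge0 k : 0 <= \prod_j w j (k j).
Proof. by apply: prodr_ge0. Qed.

Let sum_prod1 : \sum_(k : K) \prod_j w j (k j) = 1.
Proof. by rewrite -bigA_distr_bigA/= big1. Qed.

Lemma simes :
  \sum_(k : K | [exists t : 'I_#|N|.+1, simes_reject k t]) \prod_i w i (k i) <= alpha.
Proof.
have -> : \sum_(k : K | [exists t : 'I_#|N|.+1, simes_reject k t]) \prod_i w i (k i) =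
    \sum_(t < #|N|.+1) \sum_(k : K) (last_reject k t)%:R * \prod_i w i (k i).
  rewrite exchange_big/= big_mkcond/=; apply: eq_bigr => k _.
  case: ifPn => [/existsP[t /last_reject_exists[s ks]]|/existsPn kN].
    rewrite (bigD1 s)//= ks mul1r [X in _ = _ + X]big1 ?addr0// => r rs.
    by case: (boolP (last_reject k r)) => [/last_reject_uniq/(_ ks)/eqP|];
       rewrite ?(negbTE rs)// mul0r.
  rewrite big1// => t _; rewrite /last_reject.
  by rewrite (negbTE (kN t)) mul0r.
have step (t : 'I_#|N|.+1) :
    \sum_(k : K) (last_reject k t)%:R * \prod_i w i (k i) <=
    alpha / #|N|%:R * \sum_(i in N) \sum_(k : K)
      (last_reject (fupd k i ord0) t)%:R * \prod_i w i (k i).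
  have [t0|t0] := posnP t.
    rewrite big1; last by move=> k _; rewrite /last_reject /simes_reject t0 mul0r.
    rewrite mulr_ge0 ?divr_ge0//; apply: sumr_ge0 => i _; apply: sumr_ge0 => k _.
    by rewrite mulr_ge0.
  have tR : 0 < t%:R :> R by rewrite ltr0n.
  rewrite -(ler_pM2l tR).
  (* Exactly [t] coordinates lie below the last rejecting [t], so [t] times the indicator is a sum
     over them; in the term of [i] that coordinate may be reset. *)
  have -> : t%:R * \sum_(k : K) (last_reject k t)%:R * \prod_i w i (k i) =
     \sum_(i in N) \sum_(k : K)
       ((k i < t)%N)%:R * (last_reject (fupd k i ord0) t)%:R * \prod_i w i (k i).
    rewrite mulr_sumr exchange_big/=; apply: eq_bigr => k _.
    rewrite -mulr_suml mulrA; congr (_ * _).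
    transitivity (\sum_(i in N) ((k i < t)%N)%:R * ((last_reject k t)%:R : R)).
      rewrite -mulr_suml; have [kt|] := boolP (last_reject k t); last by rewrite !mulr0.
      congr (_ * _); transitivity ((count_below k t)%:R : R).
        by rewrite last_reject_count.
      rewrite /count_below -[X in X%:R = _]sum1_card natr_sum.
      rewrite big_mkcond [RHS]big_mkcond/=; apply: eq_bigr => i _.
      by rewrite inE; case: (i \in N); case: ltnP.
    apply: eq_bigr => i _; case: (ltnP (k i) t) => kt; last by rewrite !mul0r.
    by rewrite last_reject_fupd.
  rewrite mulrCA !mulr_sumr; apply: ler_sum => i iN.
  (* By independence the factor of [i] is bounded through [w_tail], whose [t] cancels the one on the
     left. *)
  rewrite (sum_ffun_decouple _ w i (fun l : 'I_q.+1 => ((l < t)%N)%:R)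
    (fun k => (last_reject k t)%:R))// mulrA.
  apply: ler_wpM2r; first by apply: sumr_ge0 => k _; rewrite mulr_ge0.
  rewrite [leRHS]mulrC mulrA.
  apply: le_trans (w_tail i t iN _); last by rewrite t0 -ltnS ltn_ord.
  rewrite [leRHS]big_mkcond/=; apply: ler_sum => l _.
  by case: ltnP; rewrite ?mul1r ?mul0r.
apply: le_trans (ler_sum _ (fun t _ => step t)) _.
rewrite -mulr_sumr exchange_big/=.
have [N0|N0] := posnP #|N|.
  by rewrite [X in X%:R]N0 invr0 mulr0 mul0r.
have {}N0 : 0 < #|N|%:R :> R by rewrite ltr0n.
rewrite -[leRHS]mulr1 -mulrA ler_wpM2l// ler_pdivrMl// mulr1.
(* For fixed [i] the events indexed by [t] are disjoint, so they weigh at most 1 together. *)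
rewrite -[X in _ <= X%:R]sum1_card natr_sum; apply: ler_sum => i _.
rewrite exchange_big/= -[leRHS]sum_prod1; apply: ler_sum => k _.
rewrite -mulr_suml ler_piMl//.
have [/existsP[s ks]|/existsPn kN] := boolP [exists t, last_reject (fupd k i ord0) t].
  rewrite (bigD1 s)//= ks [X in _ + X]big1 ?addr0// => r rs.
  case: (boolP (last_reject _ r)) => [/last_reject_uniq/(_ ks)/eqP|//].
  by rewrite (negbTE rs).
by rewrite big1// => t _; rewrite (negbTE (kN t)).
Qed.

End Simes.

(** * Rotation invariance of the planar Gaussian *)

Section Shear.
Context {R : realType}.
Local Notation mu := (@lebesgue_measure R).
Local Notation RR := (measurableTypeR R * measurableTypeR R)%type.
Local Open Scope ereal_scope.

Lemma lebesgue_measure_translate (a : R) (A : set (measurableTypeR R)) :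
  measurable A -> mu ((fun x : R => x + a)%R @^-1` A) = mu A.
Proof.
pose f : measurableTypeR R -> measurableTypeR R := fun x : R => (x + a)%R.
have mf : measurable_fun [set: measurableTypeR R] f by exact: measurable_funD.
move=> mA; apply/esym.
apply: (@lebesgue_measure_unique R (pushforward mu f)) => // _ [[x y]] _ <-/=.
rewrite /pushforward.
have -> : f @^-1` `]x, y]%classic = `](x - a)%R, (y - a)%R]%classic.
  by apply/seteqP; split=> z /=; rewrite /f !in_itv/= ltrBlDr lerBrDr.
rewrite !lebesgue_measure_itv/= !lte_fin ltrD2r; case: ifP => // _.
by rewrite -!EFinB; congr EFin; ring.
Qed.

(** [shear1] translates at a fixed second coordinate, so its sections must be taken in the other
    order of integration. *)
Lemma product_measure_swap (A : set RR) :
  measurable A -> (mu \x mu) A = (mu \x^ mu) A.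
Proof.
move=> mA; apply: product_measure_unique => // B C mB mC /=.
exact: product_measure2E.
Qed.

Definition shear1 (t : R) (z : RR) : RR := (z.1 + t * z.2, z.2)%R.

Definition shear2 (t : R) (z : RR) : RR := (z.1, z.2 + t * z.1)%R.

Lemma shear1_measurable (t : R) :
  measurable_fun [set: RR] (shear1 t).
Proof.
apply: measurable_fun_pair; last exact: measurable_snd.
by apply: measurable_funD => //; apply: measurable_funM => //.
Qed.

Lemma shear2_measurable (t : R) :
  measurable_fun [set: RR] (shear2 t).
Proof.
apply: measurable_fun_pair; first exact: measurable_fst.
by apply: measurable_funD => //; apply: measurable_funM => //.
Qed.

Lemma lebesgue_shear1 (t : R) (A : set RR) : measurable A ->
  (mu \x mu) (shear1 t @^-1` A) = (mu \x mu) A.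
Proof.
have mf := shear1_measurable t.
move=> mA; apply/esym.
apply: (@product_measure_unique _ _ _ _ R mu mu
  (pushforward (mu \x mu) (shear1 t))) => //= B C mB mC.
rewrite /pushforward product_measure_swap; last first.
  by rewrite -[X in measurable X]setTI; apply: mf => //; exact: measurableX.
rewrite /product_measure2.
rewrite (eq_integral (fun y => mu B * (\1_C y)%:E)).
  by rewrite ge0_integralZl// ?integral_indic ?setIT//; apply: measurableT_comp.
move=> y _ /=; rewrite indicE.
have -> : ysection (shear1 t @^-1` (B `*` C)) y =
  if y \in C then (fun x : R => x + t * y)%R @^-1` B else set0.
  apply/seteqP; split=> x; rewrite /ysection/= in_setE/=; case: ifPn => yC //.
  - by case.
  - by move=> [_ /mem_set]; rewrite (negbTE yC).
  - by move=> Bx; split=> //; exact: set_mem.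
case: ifPn => _; last by rewrite measure0 mule0.
by rewrite lebesgue_measure_translate// mule1.
Qed.

Lemma lebesgue_shear2 (t : R) (A : set RR) : measurable A ->
  (mu \x mu) (shear2 t @^-1` A) = (mu \x mu) A.
Proof.
have mf := shear2_measurable t.
move=> mA; apply/esym.
apply: (@product_measure_unique _ _ _ _ R mu mu
  (pushforward (mu \x mu) (shear2 t))) => //= B C mB mC.
rewrite /pushforward /product_measure1.
rewrite (eq_integral (fun x => (\1_B x)%:E * mu C)).
  by rewrite ge0_integralZr// ?integral_indic ?setIT//; apply: measurableT_comp.
move=> x _ /=; rewrite indicE.
have -> : xsection (shear2 t @^-1` (B `*` C)) x =
  if x \in B then (fun y : R => y + t * x)%R @^-1` C else set0.
  apply/seteqP; split=> y; rewrite /xsection/= in_setE/=; case: ifPn => xB //.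
  - by case.
  - by move=> [/mem_set + _]; rewrite (negbTE xB).
  - by move=> Cy; split=> //; exact: set_mem.
case: ifPn => _; last by rewrite measure0 mul0e.
by rewrite lebesgue_measure_translate// mul1e.
Qed.

Definition rotation (c s : R) (z : RR) : RR :=
  (c * z.1 - s * z.2, s * z.1 + c * z.2)%R.

Lemma rotation_measurable (c s : R) : measurable_fun [set: RR] (rotation c s).
Proof.
apply: measurable_fun_pair.
  by apply: measurable_funB => //; apply: measurable_funM.
by apply: measurable_funD => //; apply: measurable_funM.
Qed.

(* A rotation with [s != 0] is a product of three shears. *)
Lemma lebesgue_rotation (c s : R) (A : set RR) :
  (c ^+ 2 + s ^+ 2 = 1)%R -> s != 0%R -> measurable A ->
  (mu \x mu) (rotation c s @^-1` A) = (mu \x mu) A.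
Proof.
(* [t] is minus the tangent of half the angle of rotation. *)
move=> cs s0 mA; pose t := ((c - 1) / s)%R.
have ts : (t * s = c - 1)%R by rewrite divfK.
have tc : (t * (c + 1) = - s)%R.
  apply: (mulIf s0); rewrite mulrAC ts.
  have -> : ((c - 1) * (c + 1) = c ^+ 2 + s ^+ 2 - s ^+ 2 - 1)%R by ring.
  by rewrite cs; ring.
have -> : rotation c s = shear1 t \o shear2 s \o shear1 t.
  apply/funext => -[x y]; rewrite /rotation /shear1 /shear2/=; congr pair.
    have -> : (x + t * y + t * (y + s * (x + t * y)) =
      x + (t * s) * x + (t * (c + 1)) * y + (t * s - (c - 1)) * t * y)%R by ring.
    by rewrite ts tc; ring.
  have -> : (y + s * (x + t * y) = s * x + (1 + t * s) * y)%R by ring.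
  by rewrite ts; ring.
have m1 : measurable (shear1 t @^-1` A).
  by rewrite -[X in measurable X]setTI; exact: shear1_measurable.
have m2 : measurable (shear2 s @^-1` (shear1 t @^-1` A)).
  by rewrite -[X in measurable X]setTI; exact: shear2_measurable.
by rewrite !comp_preimage/= lebesgue_shear1// lebesgue_shear2// lebesgue_shear1.
Qed.

End Shear.

Section Gauss2.
Context {R : realType} (sigma : R).
Hypothesis sigma0 : sigma != 0.
Local Notation mu := (@lebesgue_measure R).
Local Notation RR := (measurableTypeR R * measurableTypeR R)%type.
Local Open Scope ereal_scope.

Definition normal_pdf2 (z : RR) : R :=
  (normal_pdf 0 sigma z.1 * normal_pdf 0 sigma z.2)%R.

(** Given by a density, so that rotation invariance splits into that of the density and that of
    Lebesgue measure; [normal_prob2X] recovers the product form. *)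
Definition normal_prob2 (X : set RR) : \bar R :=
  \int[mu \x mu]_(z in X) (normal_pdf2 z)%:E.

Lemma normal_pdf2_ge0 z : (0 <= normal_pdf2 z)%R.
Proof. by rewrite mulr_ge0// normal_pdf_ge0. Qed.

Lemma measurable_normal_pdf2 : measurable_fun [set: RR] normal_pdf2.
Proof.
by apply: measurable_funM; apply: (measurableT_comp (measurable_normal_pdf _ _)).
Qed.

Lemma normal_pdf2_rotation (c s : R) z : (c ^+ 2 + s ^+ 2 = 1)%R ->
  normal_pdf2 (rotation c s z) = normal_pdf2 z.
Proof.
move=> cs; rewrite /normal_pdf2 !normal_pdfE// /normal_fun /rotation/= !subr0.
rewrite mulrACA [RHS]mulrACA; congr (_ * _)%R; rewrite -!expRD; congr expR.
rewrite -!mulrDl -!opprD; congr (- _ / _)%R.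
transitivity ((c ^+ 2 + s ^+ 2) * (z.1 ^+ 2 + z.2 ^+ 2))%R; first by ring.
by rewrite cs mul1r.
Qed.

Let prob20 : normal_prob2 set0 = 0.
Proof. by rewrite /normal_prob2 integral_set0. Qed.

Let prob2_ge0 X : 0 <= normal_prob2 X.
Proof. by apply: integral_ge0 => z _; rewrite lee_fin normal_pdf2_ge0. Qed.

Let prob2_sigma_additive : semi_sigma_additive normal_prob2.
Proof.
move=> F mF tF mUF; rewrite /normal_prob2 ge0_integral_bigcup//=; last 2 first.
- by apply/measurable_EFinP; apply: measurable_funTS; exact: measurable_normal_pdf2.
- by move=> z _; rewrite lee_fin normal_pdf2_ge0.
apply: is_cvg_ereal_nneg_natsum_cond => n _ _.
exact: prob2_ge0.
Qed.

HB.instance Definition _ := isMeasure.Build _ _ _ normal_prob2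
  prob20 prob2_ge0 prob2_sigma_additive.

Lemma normal_prob2_rotation (c s : R) (X : set RR) : (c ^+ 2 + s ^+ 2 = 1)%R ->
  s != 0%R -> measurable X -> normal_prob2 (rotation c s @^-1` X) = normal_prob2 X.
Proof.
move=> cs s0 mX; rewrite /normal_prob2.
under eq_integral do rewrite -(normal_pdf2_rotation c s)//.
have mf := rotation_measurable c s.
have <- := @ge0_integral_pushforward _ _ _ _ R (rotation c s) mf (mu \x mu) X
  (fun z => (normal_pdf2 z)%:E) mX.
- by apply: eq_measure_integral => A mA _; exact: lebesgue_rotation.
- by apply/measurable_EFinP; apply: measurable_funTS; exact: measurable_normal_pdf2.
- by move=> z _; rewrite lee_fin normal_pdf2_ge0.
Qed.

Lemma normal_prob2X (A B : set (measurableTypeR R)) :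
  measurable A -> measurable B ->
  normal_prob2 (A `*` B) = normal_prob 0 sigma A * normal_prob 0 sigma B.
Proof.
move=> mA mB; rewrite /normal_prob2 integral_mkcond fubini_tonelli1; first last.
- by move=> z; rewrite patchE; case: ifP => // _; rewrite lee_fin normal_pdf2_ge0.
- apply/(measurable_restrictT _ _).1 => //; first exact: measurableX.
  by apply/measurable_EFinP; apply: measurable_funTS; exact: measurable_normal_pdf2.
pose p x := (normal_pdf 0 sigma x)%:E : \bar R.
have mp D : measurable_fun D p.
  by apply/measurable_EFinP; apply: measurable_funTS; exact: measurable_normal_pdf.
have mpr (D : set (measurableTypeR R)) : measurable D ->
    measurable_fun [set: measurableTypeR R] (p \_ D).
  by move=> mD; exact: iffLR (measurable_restrictT p mD) (mp D).
have p0 x : 0 <= p x by rewrite lee_fin normal_pdf_ge0.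
rewrite /fubini_F.
rewrite (eq_integral (fun x => (p \_ A) x * normal_prob 0 sigma B)).
  rewrite ge0_integralZr//.
  - by rewrite -integral_mkcond.
  - exact: mpr.
  - by move=> x _; rewrite patchE; case: ifP => // _; exact: p0.
move=> x _; rewrite /normal_prob [in RHS]integral_mkcond patchE.
case: ifPn => xA; last first.
  rewrite mul0e integral0_eq// => y _; rewrite patchE in_setX/= (negbTE xA)//.
rewrite -ge0_integralZl//; last 2 first.
- exact: mpr.
- by move=> y _; rewrite patchE; case: ifP => // _; exact: p0.
apply: eq_integral => y _; rewrite !patchE in_setX/= xA/=.
by case: ifP => _; rewrite ?mule0// EFinM.
Qed.

End Gauss2.

(** * Orthonormal images of iid Gaussian noise *)

Section IidNormal.
Context {R : realType} {d} {T : measurableType d} (P : probability T R).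
Context {n : nat} (sigma : R).
Hypothesis sigma0 : sigma != 0.
Local Notation RR := (measurableTypeR R * measurableTypeR R)%type.

(** Marginals and independence in a single formula on boxes, the invariant carried through the
    rotations. *)
Definition iid_normal (Z : 'I_n -> T -> R) : Prop :=
  (forall k, measurable_fun [set: T] (Z k)) /\
  forall B : 'I_n -> set R, (forall k, measurable (B k)) ->
    P (\bigcap_(k in [set: 'I_n]) (Z k @^-1` B k)) =
    (\prod_(k < n) normal_prob 0%R sigma (B k))%E.

(** Needed because the preimage of a rectangle under a rotation is a general planar set. Both sides
    are measures in [X] that agree on rectangles. *)
Lemma iid_normal_pair (Z : 'I_n -> T -> R) (i j : 'I_n) (B : 'I_n -> set R)
    (X : set RR) : iid_normal Z -> i != j -> (forall k, measurable (B k)) ->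
  measurable X ->
  P (\bigcap_(k in [set k | (k != i) && (k != j)]) (Z k @^-1` B k) `&`
     (fun w => (Z i w, Z j w) : RR) @^-1` X) =
  ((\prod_(k < n | (k != i) && (k != j)) normal_prob 0%R sigma (B k)) *
   normal_prob2 sigma X)%E.
Proof.
move=> [mZ ZE] ij mB mX.
set E := \bigcap_(k in _) _; pose f : T -> RR := fun w => (Z i w, Z j w).
rewrite -/f.
have mf : measurable_fun [set: T] f by apply: measurable_fun_pair; exact: mZ.
have mE : measurable E.
  apply: fin_bigcap_measurable => [|k _]; first exact: finite_finset.
  by rewrite -[X in measurable X]setTI; exact: mZ.
set c := (\prod_(k < n | _) _)%E.
have c0 : (0 <= c)%E by apply: prode_ge0 => k _; exact: measure_ge0.
have cfin : c \is a fin_num.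
  by apply: (big_ind (fun x => x \is a fin_num)) => //= [x y xf yf|k _];
    [exact: fin_numM|exact: (fin_num_measure (normal_prob 0 sigma) (B k) (mB k))].
have cE : c = (fine c)%:E by rewrite fineK.
have fc0 : 0 <= fine c by exact: fine_ge0.
(* The mass [c] of the remaining coordinates goes into one factor, giving a product measure to
   compare with. *)
pose m1 := mscale (NngNum fc0) (normal_prob 0 sigma).
have m1X A C : measurable A -> measurable C ->
    (m1 A * normal_prob 0 sigma C = c * normal_prob2 sigma (A `*` C))%E.
  by move=> mA mC; rewrite normal_prob2X// /m1 /mscale/= -cE muleA.
transitivity ((m1 \x normal_prob 0 sigma)%E X).
  have -> : P (E `&` f @^-1` X) = pushforward (mrestr P mE) f X.
    by rewrite /pushforward /mrestr setIC.
  apply/esym; apply: (@product_measure_unique _ _ _ _ R m1 (normal_prob 0 sigma)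
    (pushforward (mrestr P mE) f)) => //= A C mA mC.
  rewrite m1X// normal_prob2X// /pushforward /mrestr.
  pose B' k := if k == i then A else if k == j then C else B k.
  have -> : f @^-1` (A `*` C) `&` E = \bigcap_(k in [set: 'I_n]) (Z k @^-1` B' k).
    apply/seteqP; split=> w.
      move=> [[/= Aw Cw] Ew] k _; rewrite /B' /=.
      by case: eqVneq => [->//|ki]; case: eqVneq => [->//|kj]; apply: Ew; rewrite /= ki.
    move=> Bw; split; last first.
      by move=> k /= /andP[ki kj]; have := Bw k I; rewrite /B' (negbTE ki) (negbTE kj).
    split; first by have := Bw i I; rewrite /B' eqxx.
    by have := Bw j I; rewrite /B' eqxx eq_sym (negbTE ij).
  rewrite ZE; last by move=> k; rewrite /B'; case: ifP => // _; case: ifP.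
  rewrite (bigD1 i)//= (bigD1 j)/= ?[j == i]eq_sym//.
  rewrite /B' !eqxx [j == i]eq_sym (negbTE ij) muleA muleC; congr (_ * _)%E.
  by apply: eq_bigr => k /andP[/negbTE -> /negbTE ->].
have -> : (c * normal_prob2 sigma X = mscale (NngNum fc0) (normal_prob2 sigma) X)%E.
  by rewrite /mscale/= -cE.
apply: (@product_measure_unique _ _ _ _ R m1 (normal_prob 0 sigma)
    (mscale (NngNum fc0) (normal_prob2 sigma))) => //= A C mA mC.
by rewrite m1X// /mscale/= -cE.
Qed.

Definition givens (c s : R) (i j : 'I_n) (v : 'I_n -> R) (k : 'I_n) : R :=
  if k == i then c * v i - s * v j
  else if k == j then s * v i + c * v j else v k.

(** Serves twice: for two rows it preserves orthonormality, for a row and the noise it preserves the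
    observed combination. *)
Lemma givens_dot (c s : R) (i j : 'I_n) (u v : 'I_n -> R) : i != j ->
  c ^+ 2 + s ^+ 2 = 1 ->
  \sum_k givens c s i j u k * givens c s i j v k = \sum_k u k * v k.
Proof.
move=> ij cs; have ji : j != i by rewrite eq_sym.
rewrite (bigD1 i)//= [RHS](bigD1 i)//= (bigD1 j)//= [X in _ = _ + X](bigD1 j)//=.
rewrite (eq_bigr (fun k => u k * v k)); last first.
  by move=> k /andP[/negbTE ki /negbTE kj]; rewrite /givens ki kj.
rewrite !addrA; congr (_ + _); rewrite /givens !eqxx (negbTE ji).
transitivity ((c ^+ 2 + s ^+ 2) * (u i * v i + u j * v j)); first by ring.
by rewrite cs mul1r.
Qed.

Lemma iid_normal_givens (Z : 'I_n -> T -> R) (i j : 'I_n) (c s : R) : i != j ->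
  c ^+ 2 + s ^+ 2 = 1 -> s != 0 -> iid_normal Z ->
  iid_normal (fun k w => givens c s i j (Z^~ w) k).
Proof.
move=> ij cs s0 ZI; have [mZ ZE] := ZI; split.
  move=> k; rewrite /givens; case: eqP => _.
    by apply: measurable_funB; apply: measurable_funM.
  by case: eqP => _; [apply: measurable_funD; apply: measurable_funM|].
move=> B mB.
pose X : set RR := B i `*` B j.
have mX : measurable X by apply: measurableX; exact: mB.
have mrX : measurable (rotation c s @^-1` X).
  by rewrite -[Y in measurable Y]setTI; apply: rotation_measurable.
have -> : \bigcap_(k in [set: 'I_n]) ((fun w => givens c s i j (Z^~ w) k) @^-1` B k) =
    \bigcap_(k in [set k | (k != i) && (k != j)]) (Z k @^-1` B k) `&`
    (fun w => (Z i w, Z j w) : RR) @^-1` (rotation c s @^-1` X).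
  apply/seteqP; split=> w.
    move=> Bw; split.
      by move=> k /= /andP[ki kj]; have := Bw k I; rewrite /givens/= (negbTE ki) (negbTE kj).
    have := Bw i I; have := Bw j I.
    by rewrite /givens/= !eqxx [j == i]eq_sym (negbTE ij).
  move=> [Ew [/= Xi Xj]] k _; rewrite /givens/=.
  case: eqVneq => [->//|ki]; case: eqVneq => [->//|kj].
  by apply: Ew; rewrite /= ki.
rewrite iid_normal_pair// normal_prob2_rotation// normal_prob2X//; [|exact: mB|exact: mB].
rewrite [RHS](bigD1 i)//= [X in _ = (_ * X)%E](bigD1 j)/= ?[j == i]eq_sym//.
by rewrite [RHS]muleA [RHS]muleC.
Qed.

Definition orthonormal_rows (m : nat) (A : 'I_m -> 'I_n -> R) : Prop :=
  forall a b, \sum_k A a k * A b k = (a == b)%:R.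

Lemma orthonormal_reduction (m : nat) (A : 'I_m -> 'I_n -> R) (Z : 'I_n -> T -> R)
    (mn : (m <= n)%N) :
  orthonormal_rows m A -> iid_normal Z ->
  exists2 Z', iid_normal Z' & forall a w,
    `|\sum_k A a k * Z k w| = `|Z' (widen_ord mn a) w|.
Proof.
move=> A_on ZI.
pose reach A' Z' := [/\ orthonormal_rows m A', iid_normal Z' &
  forall a w, \sum_k A' a k * Z' k w = \sum_k A a k * Z k w].
pose diag_upto t (A' : 'I_m -> 'I_n -> R) := forall (a : 'I_m) (l : 'I_n),
  (a < t)%N -> l != widen_ord mn a -> A' a l = 0.
have diagE A' t (a : 'I_m) (v : 'I_n -> R) : diag_upto t A' -> (a < t)%N ->
    \sum_k A' a k * v k = A' a (widen_ord mn a) * v (widen_ord mn a).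
  move=> dA at_; rewrite (bigD1 (widen_ord mn a))//= big1 ?addr0// => k ka.
  by rewrite (dA a k at_ ka) mul0r.
have : forall t, (t <= m)%N -> exists A' Z', reach A' Z' /\ diag_upto t A'.
  elim=> [_|t IH tm]; first by exists A, Z; split.
  have {IH}[A0 [Z0 [AZ0 dA0]]] := IH (ltnW tm).
  pose r := Ordinal tm; pose i := widen_ord mn r.
  (* Inner induction: clear row [r] to the right of its diagonal, one column at a time. Rows already
     treated vanish in both rotated columns and stay intact. *)
  have : forall l, (l <= n)%N -> exists A' Z', [/\ reach A' Z', diag_upto t A' &
      forall l' : 'I_n, (t < l' < l)%N -> A' r l' = 0].
    elim=> [_|l IH ln].
      by exists A0, Z0; split => // l'; rewrite ltn0 andbF.
    have {IH}[A1 [Z1 [[on1 Z1I AZ1] dA1 zA1]]] := IH (ltnW ln).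
    pose j := Ordinal ln.
    have [tl|lt_] := leqP l t.
      exists A1, Z1; split => // l' /andP[tl' l'l]; apply: zA1.
      by rewrite tl'/=; move: (leq_ltn_trans tl tl'); rewrite ltnNge -ltnS l'l.
    have [b0|b0] := eqVneq (A1 r j) 0.
      exists A1, Z1; split => // l' /andP[tl']; rewrite ltnS leq_eqVlt => /predU1P[l'l|l'l].
        by rewrite (_ : l' = j)//; exact: val_inj.
      by apply: zA1; rewrite tl'.
    (* The rotation sends the pair of entries of row [r] in columns [i] and [j] to [(q, 0)]. *)
    pose q := Num.sqrt (A1 r i ^+ 2 + A1 r j ^+ 2).
    have q2 : q ^+ 2 = A1 r i ^+ 2 + A1 r j ^+ 2.
      by rewrite sqr_sqrtr// addr_ge0// sqr_ge0.
    have q0 : q != 0.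
      rewrite -sqrf_eq0 q2 paddr_eq0 ?sqr_ge0// !expf_eq0/=.
      by rewrite (negbTE b0) andbF.
    pose c := A1 r i / q; pose s := - A1 r j / q.
    have cs : c ^+ 2 + s ^+ 2 = 1.
      by rewrite /c /s !exprMn sqrrN -mulrDl -q2 exprVn divff// expf_neq0.
    have s0 : s != 0 by rewrite /s mulf_neq0 ?invr_eq0// oppr_eq0.
    have ij : i != j by rewrite -val_eqE/= ltn_eqF.
    exists (fun a => givens c s i j (A1 a)), (fun k w => givens c s i j (Z1^~ w) k).
    split.
    - split; first by move=> a b; rewrite givens_dot.
      + exact: iid_normal_givens.
      + by move=> a w; rewrite givens_dot.
    - move=> a k at_ ka.
      have ai : A1 a i = 0 by apply: dA1 => //; rewrite -val_eqE/= gtn_eqF.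
      have aj : A1 a j = 0.
        by apply: dA1 => //; rewrite -val_eqE/= gtn_eqF// (ltn_trans at_).
      rewrite /givens ai aj !mulr0 subr0 addr0.
      by case: ifP => // _; case: ifP => // _; exact: dA1.
    - move=> l' /andP[tl']; rewrite ltnS leq_eqVlt => /predU1P[l'l|l'l].
        have -> : l' = j by exact: val_inj.
        rewrite /givens eqxx [j == i]eq_sym (negbTE ij) /s /c.
        by field.
      rewrite /givens -!val_eqE/= gtn_eqF// ltn_eqF//.
      by apply: zA1; rewrite tl'.
  move=> /(_ n (leqnn n))[A' [Z' [[on' ZI' AZ'] dA' zA']]].
  exists A', Z'; split => // a l; rewrite ltnS leq_eqVlt => /predU1P[at_|at_]; last exact: dA'.
  have -> : a = r by exact: val_inj.
  move=> lr; have [lt_|lt_|lt_] := ltngtP l t; last first.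
  - by move: lr; rewrite -val_eqE/= lt_ eqxx.
  - by apply: zA'; rewrite lt_/=.
  pose a' := Ordinal (ltn_trans lt_ tm).
  have la' : l = widen_ord mn a' by exact: val_inj.
  have := on' a' a'; rewrite (diagE _ t)// eqxx => aa.
  have := on' a' r; rewrite (diagE _ t)// -la' -val_eqE/= ltn_eqF// => /eqP.
  rewrite mulf_eq0 => /orP[/eqP|/eqP//].
  by move: aa; rewrite -la' => + a0; rewrite a0 mul0r => /esym/eqP; rewrite oner_eq0.
move=> /(_ m (leqnn m))[A' [Z' [[on' ZI' AZ'] dA']]].
exists Z' => // a w; rewrite -AZ' (diagE _ m)// normrM.
have := on' a a; rewrite (diagE _ m)// eqxx => /eqP.
rewrite -expr2 sqrf_eq1 => /orP[/eqP ->|/eqP ->]; rewrite ?normrN normr1 mul1r//.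
Qed.

End IidNormal.

(** * The normal quantile function *)

Section NormalScale.
Context {R : realType}.
Local Notation mu := (@lebesgue_measure R).
Local Open Scope ereal_scope.

Lemma lebesgue_measure_scale (s : R) (A : set (measurableTypeR R))
    (s0 : (0 < s)%R) :
  measurable A -> mu A = s%:E * mu ((fun x : R => s * x)%R @^-1` A).
Proof.
pose f : measurableTypeR R -> measurableTypeR R := fun x : R => (s * x)%R.
have mf : measurable_fun [set: measurableTypeR R] f by exact: measurable_funM.
move=> mA.
have -> : s%:E * mu (f @^-1` A) = mscale (NngNum (ltW s0)) (pushforward mu f) A by [].
apply: (@lebesgue_measure_unique R
  (mscale (NngNum (ltW s0)) (pushforward mu f))) => // _ [[x y]] _ <-/=.
rewrite /mscale/= /pushforward.
have -> : f @^-1` `]x, y]%classic = `](x / s)%R, (y / s)%R]%classic.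
  apply/seteqP; split=> z /=;
    by rewrite /f !in_itv/= ltr_pdivrMr// ler_pdivlMr// ![(z * s)%R]mulrC.
rewrite !lebesgue_measure_itv/= !lte_fin ltr_pM2r ?invr_gt0//.
case: ifP => // _; rewrite ?mule0//.
by rewrite -!EFinB -EFinM; congr EFin; field; rewrite gt_eqF.
Qed.

Lemma normal_prob_scale (s : R) (A : set (measurableTypeR R)) : (0 < s)%R ->
  measurable A ->
  normal_prob 0 s A = normal_prob 0 1 ((fun x : R => s * x)%R @^-1` A).
Proof.
move=> s0 mA; pose f : measurableTypeR R -> measurableTypeR R := fun x : R => (s * x)%R.
have mf : measurable_fun [set: measurableTypeR R] f by exact: measurable_funM.
have mp D : measurable_fun D (fun x => (normal_pdf 0 s x)%:E).
  by apply/measurable_EFinP; apply: measurable_funTS; exact: measurable_normal_pdf.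
have p0 x : 0 <= (normal_pdf 0 s x)%:E by rewrite lee_fin normal_pdf_ge0.
rewrite /normal_prob.
pose nu := mscale (NngNum (ltW s0)) mu.
transitivity (\int[pushforward nu f]_(x in A) (normal_pdf 0 s x)%:E).
  by apply: eq_measure_integral => //= B mB _; exact: lebesgue_measure_scale.
have -> := @ge0_integral_pushforward _ _ _ _ R f mf nu A
  (fun x => (normal_pdf 0 s x)%:E) mA; [|exact: mp|by []].
have mfA : measurable (f @^-1` A) by rewrite -[X in measurable X]setTI; exact: mf.
have mpf D : measurable_fun D (fun x => (normal_pdf 0 s (f x))%:E).
  by apply: measurable_funTS; exact: (measurableT_comp (mp setT) mf).
rewrite ge0_integral_mscale//=.
rewrite -ge0_integralZl//=; last by rewrite lee_fin ltW.
apply: eq_integral => x _ /=; rewrite -EFinM; congr EFin.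
rewrite !normal_pdfE ?oner_eq0 ?gt_eqF// /normal_peak /normal_fun /f !subr0 mulrA.
congr (_ * expR _)%R.
  rewrite expr1n mul1r -mulrnAr sqrtrM ?sqr_ge0// sqrtr_sqr gtr0_norm// invfM mulrA.
  by rewrite divff ?mul1r// gt_eqF.
by rewrite !mulNr; congr (- _)%R; field; rewrite gt_eqF.
Qed.

Lemma normal_probN (s : R) (A : set (measurableTypeR R)) : (0 < s)%R ->
  measurable A -> normal_prob 0 s (-%R @^-1` A) = normal_prob 0 s A.
Proof.
move=> s0 mA; pose f : measurableTypeR R -> measurableTypeR R := (-%R : R -> R).
have mf : measurable_fun [set: measurableTypeR R] f by exact: oppr_measurable.
rewrite /normal_prob.
transitivity (\int[pushforward mu f]_(x in A) (normal_pdf 0 s x)%:E); last first.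
  by apply: eq_measure_integral => //= B mB _; exact: lebesgue_measureN.
have -> := @ge0_integral_pushforward _ _ _ _ R f mf mu A
  (fun x => (normal_pdf 0 s x)%:E) mA.
- apply: eq_integral => x _ /=; congr EFin.
  by rewrite !normal_pdfE ?gt_eqF// /normal_fun /f !subr0 sqrrN.
- by apply/measurable_EFinP; apply: measurable_funTS; exact: measurable_normal_pdf.
- by move=> x _; rewrite lee_fin normal_pdf_ge0.
Qed.

End NormalScale.

Section Quantile.
Import numFieldNormedType.Exports.
Context {R : realType}.
Implicit Types x p t : R.

(** As a random variable under N(0,1) the identity has cdf [Phi], which gives access to the limits
    of a cdf. *)
Let idR : measurableTypeR R -> R := idfun.

#[local] HB.instance Definition _ :=
  @isMeasurableFun.Build _ _ _ _ idR (@measurable_id _ _ setT).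

Let Z : {RV (normal_prob (0:R) 1) >-> R} := idR.

Lemma PhiE x : (Phi x)%:E = normal_prob (0:R) 1 `]-oo, x].
Proof. by rewrite /Phi fineK// fin_num_measure. Qed.

Let cdfZ x : cdf Z x = (Phi x)%:E.
Proof. by rewrite PhiE /cdf /distribution /pushforward preimage_id. Qed.

Lemma Phi_nondecreasing : {homo @Phi R : x y / x <= y}.
Proof. by move=> x y xy; rewrite -lee_fin -!cdfZ cdf_nondecreasing. Qed.

Let Phi_cdf : @Phi R = fine \o cdf Z.
Proof. by apply/funext => x; rewrite [RHS](congr1 fine (cdfZ x)). Qed.

Lemma Phi_cvgy : Phi x @[x --> +oo] --> (1 : R).
Proof. by rewrite Phi_cdf; exact/fine_cvg/cvg_cdfy1. Qed.

Lemma Phi_cvgNy : Phi x @[x --> -oo] --> (0 : R).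
Proof. by rewrite Phi_cdf; exact/fine_cvg/cvg_cdfNy0. Qed.

Lemma Phi_right_continuous x : Phi y @[y --> x^'+] --> Phi x.
Proof.
have := @cdf_right_continuous _ _ R _ Z x; rewrite cdfZ => /fine_cvg.
by rewrite -Phi_cdf.
Qed.

Lemma quantile_set_has_inf p : 0 < p < 1 -> has_inf [set x : R | p <= Phi x].
Proof.
move=> /andP[p0 p1]; split.
  have /(_ _ _ p1) := cvgr_gt _ Phi_cvgy.
  by move=> /filter_ex[x /ltW px]; exists x.
have /(_ _ _ p0) := cvgr_lt _ Phi_cvgNy.
move=> [M [_ MP]]; exists M => x /= px; rewrite leNgt; apply/negP => /MP.
by rewrite ltNge px.
Qed.

Lemma le_Phi_inv p q : 0 < p -> p <= q -> q < 1 -> Phi_inv p <= Phi_inv q :> R.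
Proof.
move=> p0 pq q1.
have [_ lbp] : has_inf [set x : R | p <= Phi x] by apply: quantile_set_has_inf; lra.
have [neq _] : has_inf [set x : R | q <= Phi x] by apply: quantile_set_has_inf; lra.
by apply: lb_le_inf => // x qx; apply: ge_inf => //=; exact: le_trans qx.
Qed.

(** Right continuity at the infimum suffices, and this inequality is the direction that bounds tails
    from above. *)
Lemma Phi_Phi_inv p : 0 < p < 1 -> p <= Phi (Phi_inv p : R).
Proof.
move=> p01; have hinf := quantile_set_has_inf p p01.
apply: (cvgr_to_ge (Phi_right_continuous (Phi_inv p))).
near=> y.
have : Phi_inv p < y by near: y; exact: nbhs_right_gt.
move=> /(inf_lt hinf.1)[z /= pz zy].
by apply: le_trans pz _; apply: Phi_nondecreasing; exact: ltW.
Unshelve. all: by end_near. Qed.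

Lemma normal_tail t : (normal_prob (0:R) 1 `]t, +oo[ = (1 - Phi t)%:E)%E.
Proof.
rewrite EFinB PhiE -setCitvl probability_setC//. 
Qed.

(** A union bound over the two tails, valid whatever the sign of [t]. *)
Lemma normal_two_sided_tail (s t : R) : 0 < s ->
  (normal_prob (0:R) s [set x : R | (s * t < `|x|)%R] <= (2 * (1 - Phi t))%:E)%E.
Proof.
move=> s0.
have mA : measurable (`](s * t), +oo[%classic : set (measurableTypeR R)).
  exact: measurable_itv.
have E : normal_prob (0:R) s `](s * t), +oo[ = (1 - Phi t)%:E.
  rewrite normal_prob_scale// -normal_tail; congr (normal_prob _ _ _).
  by apply/seteqP; split=> x /=; rewrite !in_itv/= !andbT ltr_pM2l.
have -> : [set x : R | s * t < `|x|] =
    `](s * t), +oo[%classic `|` (-%R @^-1` `](s * t), +oo[%classic).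
  by apply/seteqP; split=> x /=; rewrite !in_itv/= !andbT ltr_normr => /orP.
rewrite mulr_natl mulr2n EFinD.
apply: le_trans (measureU2 _ _ _) _ => //.
  by rewrite -[X in measurable X]setTI; exact: oppr_measurable.
by rewrite /= normal_probN// E.
Qed.

(** The half-line up to [x] and its mirror image are disjoint and have equal mass. *)
Lemma Phi_le_half x : x < 0 -> Phi x <= 2^-1.
Proof.
move=> x0; pose A : set (measurableTypeR R) := `]-oo, x]%classic.
have mA : measurable A by exact: measurable_itv.
have mNA : measurable (-%R @^-1` A : set (measurableTypeR R)).
  by rewrite -[X in measurable X]setTI; exact: oppr_measurable.
have : (normal_prob (0:R) 1 (A `|` (-%R @^-1` A)) <= 1)%E.
  by apply: probability_le1; exact: measurableU.
rewrite measureU//=; last first.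
  apply/seteqP; split=> y //=; rewrite /A/= !in_itv/= => -[yx yx'].
  by lra.
rewrite normal_probN// -PhiE -EFinD lee_fin; lra.
Qed.

Lemma Phi_inv_ge0 p : 2^-1 < p < 1 -> 0 <= Phi_inv p :> R.
Proof.
move=> /andP[p2 p1].
have [ne _] : has_inf [set x : R | p <= Phi x] by apply: quantile_set_has_inf; lra.
apply: lb_le_inf => // x /= px; rewrite leNgt; apply/negP => /Phi_le_half.
by rewrite leNgt (lt_le_trans p2).
Qed.

End Quantile.

(** * Control of the false discovery proportion *)

(* The countably many rational boxes contained in [O] cover it. *)
Lemma measurable_open_preimage (R : realType) d (T : measurableType d) (m : nat)
    (Y : 'I_m -> T -> R) (O : set T) :
  (forall j, measurable_fun [set: T] (Y j)) ->
  (forall w, O w -> exists2 e, 0 < e &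
     forall w', (forall j, `|Y j w - Y j w'| <= e) -> O w') ->
  measurable O.
Proof.
move=> mY Oopen.
pose box (p : {ffun 'I_m -> rat} * rat) :=
  \bigcap_(j in [set: 'I_m])
    (Y j @^-1` `](ratr (p.1 j) - ratr p.2), (ratr (p.1 j) + ratr p.2)[).
have mbox p : measurable (box p).
  apply: fin_bigcap_measurable => [|j _]; first exact: finite_finset.
  by rewrite -[X in measurable X]setTI; apply: mY => //; exact: measurable_itv.
pose G p := if `[< box p `<=` O >] then box p else set0.
have -> : O = \bigcup_p G p.
  apply/seteqP; split => [w Ow|w [p _]]; last first.
    by rewrite /G; case: asboolP => // + pw; apply.
  have [e e0 eO] := Oopen w Ow.
  have e20 : 0 < e / 2 by rewrite divr_gt0.
  have [r] := rat_in_itvoo e20; rewrite in_itv/= => /andP[r0 re].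
  have /choice[q qP] : forall j, exists q, Y j w - ratr r < ratr q < Y j w + ratr r.
    move=> j; have : Y j w - ratr r < Y j w + ratr r by lra.
    by move=> /rat_in_itvoo[q]; rewrite in_itv/=; exists q.
  exists ([ffun j => q j], r) => //; rewrite /G; case: asboolP => [_|[]].
    by move=> j _ /=; rewrite in_itv/= ffunE; have /andP[] := qP j; lra.
  move=> w' w'b; apply: eO => j; have := w'b j I; have /andP[] := qP j.
  by rewrite /= in_itv/= ffunE => ? ? /andP[? ?]; rewrite ler_norml; lra.
apply: countable_bigcupT_measurable; first exact: countableP.
by move=> p; rewrite /G; case: asboolP.
Qed.

Lemma measure_bigsetU_le (R : realType) d (T : measurableType d)
    (mu : {measure set T -> \bar R}) (I : Type) (r : seq I) (P : pred I)
    (F : I -> set T) : (forall i, P i -> measurable (F i)) ->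
  (mu (\big[setU/set0]_(i <- r | P i) F i) <= \sum_(i <- r | P i) mu (F i))%E.
Proof.
move=> mF; elim: r => [|i r IH]; first by rewrite !big_nil measure0.
rewrite !big_cons; case: ifPn => // Pi.
apply: le_trans (measureU2 _ _ _) _; [exact: mF|exact: bigsetU_measurable|].
by rewrite leeD2l.
Qed.

(** * Discrete levels of a real random variable *)

Section Levels.
Context {R : realType} (mu : probability (measurableTypeR R) R).
Variables (q : nat) (level : measurableTypeR R -> nat).
Hypothesis level_measurable : forall k, measurable [set x | (level x < k)%N].

Definition level_weight (l : 'I_q.+1) : R := fine (mu [set x | level x = l]).

Lemma measurable_level_eq l : measurable [set x : measurableTypeR R | level x = l].
Proof.
have -> : [set x | level x = l] =
    [set x | (level x < l.+1)%N] `\` [set x | (level x < l)%N].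
  apply/seteqP; split => x /=.
    by move=> ->; rewrite ltnS leqnn ltnn.
  rewrite ltnS => -[xl /negP]; rewrite -leqNgt => lx.
  by apply/eqP; rewrite eqn_leq xl lx.
exact: measurableD.
Qed.

Lemma sum_level_weight k : (k <= q.+1)%N ->
  \sum_(l < q.+1 | (l < k)%N) level_weight l = fine (mu [set x | (level x < k)%N]).
Proof.
move=> kq; rewrite /level_weight.
rewrite -(big_ord_widen _ (fun l : nat => fine (mu [set x | level x = l])) kq).
elim: k {kq} => [|k IH].
  by rewrite big_ord0 (_ : [set x | _] = set0) ?measure0//; apply/seteqP; split.
rewrite big_ord_recr/= IH -fineD ?fin_num_measure//; [|exact: measurable_level_eq..].
rewrite -measureU//; first last.
- by apply/seteqP; split => x //= [xk xE]; move: xk; rewrite xE ltnn.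
- exact: measurable_level_eq.
congr (fine (mu _)); apply/seteqP; split => x /=.
  by move=> [/ltnW//|->]; rewrite ltnS.
by rewrite ltnS leq_eqVlt => /predU1P[->|->]; [right|left].
Qed.

Lemma level_weight_sum1 : (forall x, (level x <= q)%N) -> \sum_l level_weight l = 1.
Proof.
move=> lq; have := sum_level_weight q.+1 (leqnn _).
rewrite (eq_bigl xpredT); last by move=> l; rewrite ltn_ord.
move=> ->; rewrite (_ : [set x | _] = setT) ?probability_setT//.
by apply/seteqP; split => x //= _; rewrite ltnS.
Qed.

End Levels.

(** * The critical values of F-SLOPE *)

Section LambdaFDP.
Context {R : realType} (m : nat) (alpha gamma : R).
Hypothesis alpha01 : 0 < alpha < 1.
Hypothesis gamma01 : 0 < gamma < 1.

Let f (i : nat) : R := (Num.floor (gamma * i.+1%:R))%:~R.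
(** [rate i * alpha] is the critical two-sided p-value for [i.+1] selections. *)
Let rate (i : nat) : R := (f i + 1) / (m%:R + f i + 1 - i.+1%:R).

Let f_ge0 i : 0 <= f i.
Proof. by rewrite ler0z floor_ge0 mulr_ge0//; case/andP: gamma01 => /ltW. Qed.

Let f_homo i j : (i <= j)%N -> f i <= f j.
Proof.
move=> ij; rewrite ler_int; apply: le_floor.
by rewrite ler_wpM2l ?ler_nat//; case/andP: gamma01 => /ltW.
Qed.

Lemma lambda_FDP_rate (i : 'I_m) :
  lambda_FDP m alpha gamma i = Phi_inv (1 - rate i * alpha / 2).
Proof.
rewrite /lambda_FDP -/(f i); congr (Phi_inv (1 - _)); rewrite /rate.
have := f_ge0 i; have : (i.+1%:R : R) <= m%:R by rewrite ler_nat.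
by move=> ? ?; field; lra.
Qed.

(** The upper bound puts the quantile argument above one half, so the weights are nonnegative and
    the penalty convex. *)
Lemma rate_bounds (i : 'I_m) : 0 < rate i <= 1.
Proof.
have := f_ge0 i; have : (i.+1%:R : R) <= m%:R by rewrite ler_nat.
move=> ? ?; rewrite /rate divr_gt0; try lra.
by rewrite ler_pdivrMr /=; lra.
Qed.

Let rate_homo (i j : 'I_m) : (i <= j)%N -> rate i <= rate j.
Proof.
move=> ij; have := f_ge0 i; have := f_homo _ _ ij.
have : (j.+1%:R : R) <= m%:R by rewrite ler_nat.
have : (i.+1%:R : R) <= j.+1%:R by rewrite ler_nat.
move=> ? ? ? ?; rewrite /rate ler_pdivrMr; last lra.
rewrite mulrAC ler_pdivlMr; last lra.
(* After clearing denominators the gap is the sum of these two products. *)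
have : 0 <= (f i + 1) * (j.+1%:R - i.+1%:R) by apply: mulr_ge0; lra.
have : 0 <= (f j - f i) * (m%:R - i.+1%:R) by apply: mulr_ge0; lra.
nra.
Qed.

Lemma lambda_FDP_ni (i j : 'I_m) : (i <= j)%N ->
  lambda_FDP m alpha gamma j <= lambda_FDP m alpha gamma i.
Proof.
move=> ij; rewrite !lambda_FDP_rate.
have := rate_homo _ _ ij.
have /andP[a0 a1] := alpha01.
have /andP[? ?] := rate_bounds i; have /andP[? ?] := rate_bounds j.
by move=> ?; apply: le_Phi_inv; nra.
Qed.

Lemma lambda_FDP_ge0 (i : 'I_m) : 0 <= lambda_FDP m alpha gamma i.
Proof.
rewrite lambda_FDP_rate; apply: Phi_inv_ge0; have /andP[? ?] := rate_bounds i.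
by have /andP[a0 a1] := alpha01; apply/andP; split; nra.
Qed.

(* [n0] is the number of nulls and [V] that of false discoveries among [i.+1]
   selections, so that [n0 <= m - (i.+1 - V)]. *)
Lemma simes_le_lambda_FDP (i : 'I_m) (V n0 : nat) : (V <= i.+1)%N ->
  (0 < V <= n0)%N -> (n0 + i.+1 <= m + V)%N -> gamma * i.+1%:R < V%:R ->
  Phi_inv (1 - V%:R * alpha / n0%:R / 2) <= lambda_FDP m alpha gamma i.
Proof.
move=> Vi /andP[V0 Vn0] n0i gV; rewrite lambda_FDP_rate.
have fV : f i + 1 <= V%:R.
  have : (Num.floor (gamma * i.+1%:R) < V%:Z)%R.
    rewrite -(ltr_int R); apply: le_lt_trans gV; exact: floor_le.
  rewrite -lezD1 -(ler_int R) intrD; exact.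
have ? := f_ge0 i.
have ? : (i.+1%:R : R) <= m%:R by rewrite ler_nat.
have ? : (0 : R) < V%:R by rewrite ltr0n.
have ? : (V%:R : R) <= n0%:R by rewrite ler_nat.
have h : (n0%:R : R) + i.+1%:R <= m%:R + V%:R by rewrite -!natrD ler_nat.
have rV : rate i <= V%:R / n0%:R.
  rewrite /rate ler_pdivrMr; last lra.
  rewrite mulrAC ler_pdivlMr; last lra.
  (* The first product reflects that [x / (m - i.+1 + x)] grows with [x], the second that [n0] is at
     most [m - i.+1 + V]; they add up to the gap. *)
  have : 0 <= (V%:R - (f i + 1)) * (m%:R - i.+1%:R) by apply: mulr_ge0; lra.
  have : 0 <= (f i + 1) * (m%:R + V%:R - i.+1%:R - n0%:R) by apply: mulr_ge0; lra.
  nra.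
have Vn1 : V%:R / n0%:R <= 1 :> R by rewrite ler_pdivrMr; lra.
have -> : V%:R * alpha / n0%:R = V%:R / n0%:R * alpha :> R by rewrite mulrAC.
have /andP[? ?] := rate_bounds i; have /andP[a0 a1] := alpha01.
set r := V%:R / n0%:R in rV Vn1 *.
have ? : 0 < r by lra.
by apply: le_Phi_inv; nra.
Qed.

End LambdaFDP.

(** * Simes' inequality for Gaussian coordinates *)

Lemma simes_normal (R : realType) d (T : measurableType d) (P : probability T R)
    (n : nat) (sigma alpha : R) (Z : 'I_n -> T -> R) (N : {set 'I_n}) (O : set T) :
  0 < sigma -> 0 < alpha < 1 -> iid_normal P sigma Z -> measurable O ->
  (forall w, O w -> exists V : nat, (0 < V)%N /\
     (V <= #|[pred i in N |
        (sigma * Phi_inv (1 - V%:R * alpha / #|N|%:R / 2) < `|Z i w|)%R]|)%N) ->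
  (P O <= alpha%:E)%E.
Proof.
move=> s0 alpha01 [mZ ZE] mO OV; have /andP[a0 a1] := alpha01.
have [n00|n00] := posnP #|N|.
  suff -> : O = set0 by rewrite measure0 lee_fin ltW.
  apply/seteqP; split => // w /OV[V [V0]]; rewrite leqNgt => /negP; apply.
  apply: leq_ltn_trans V0; rewrite -n00.
  by apply: subset_leq_card; apply/fintype.subsetP => i; rewrite !inE => /andP[].
set n0 := #|N|; have n0R : 0 < n0%:R :> R by rewrite ltr0n.
pose pv (k : nat) : R := k%:R * alpha / n0%:R / 2.
pose t (k : nat) : R := Phi_inv (1 - pv k).
have pv_bounds k : (0 < k <= n0)%N -> 0 < pv k < 2^-1.
  move=> /andP[k0 kn]; have kR : 0 < k%:R :> R by rewrite ltr0n.
  have knR : k%:R <= n0%:R :> R by rewrite ler_nat.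
  rewrite /pv !divr_gt0 ?mulr_gt0//= -[ltRHS]mul1r ltr_pM2r ?invr_gt0//.
  by rewrite ltr_pdivrMr// mul1r; nra.
have t_ni k l : (0 < k)%N -> (k <= l)%N -> (l <= n0)%N -> t l <= t k.
  move=> k0 kl ln.
  have /andP[? ?] : 0 < pv k < 2^-1 by apply: pv_bounds; rewrite k0 (leq_trans kl).
  have /andP[? ?] : 0 < pv l < 2^-1 by apply: pv_bounds; rewrite ln (leq_trans k0).
  have : pv k <= pv l.
    by rewrite /pv !ler_pM2r ?invr_gt0// ler_nat.
  by move=> ?; apply: le_Phi_inv; lra.
(* The thresholds [t] are nonincreasing, so the first one exceeded determines all later ones. [find]
   is 0-based while [t] starts at 1, and it returns [n0] when none is exceeded. *)
pose level (x : measurableTypeR R) : nat :=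
  find (fun k => sigma * t k.+1 < `|x|) (iota 0 n0).
have level_le x : (level x <= n0)%N by rewrite -[leqRHS](size_iota 0) find_size.
have level_lt x k : (0 < k <= n0)%N -> (level x < k)%N = (sigma * t k < `|x|).
  move=> /andP[k0 kn]; apply/idP/idP => [lk|tx].
    have ln : (level x < n0)%N by exact: leq_trans lk kn.
    have /(nth_find 0%N) : has (fun k => sigma * t k.+1 < `|x|) (iota 0 n0).
      by rewrite has_find size_iota.
    rewrite -/(level x) nth_iota// add0n; apply: le_lt_trans.
    by rewrite ler_pM2l// t_ni.
  rewrite ltnNge; apply/negP => kl.
  have k1 : (k.-1 < level x)%N by rewrite prednK.
  have kn1 : (k.-1 < n0)%N by rewrite prednK.
  by have := before_find 0%N k1; rewrite nth_iota// add0n prednK// tx.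
have mlevel k : measurable [set x : measurableTypeR R | (level x < k)%N].
  have [->|k0] := posnP k.
    by rewrite (_ : [set x | _] = set0)//; apply/seteqP; split.
  have [kn|nk] := leqP k n0; last first.
    rewrite (_ : [set x | _] = setT)//; apply/seteqP; split => x //= _.
    exact: leq_ltn_trans (level_le x) nk.
  rewrite (_ : [set x | _] =
    (fun x : measurableTypeR R => `|x|) @^-1` `](sigma * t k), +oo[).
    by rewrite -[X in measurable X]setTI; apply: normr_measurable.
  by apply/seteqP; split => x /=; rewrite level_lt ?k0// in_itv/= andbT.
pose nu : probability (measurableTypeR R) R := normal_prob 0 sigma.
pose w0 := level_weight nu n0 level.
have w0_tail (k : nat) : (0 < k <= n0)%N ->
    \sum_(l < n0.+1 | (l < k)%N) w0 l <= k%:R * alpha / n0%:R.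
  move=> kn; rewrite sum_level_weight//; last by case/andP: kn => _ /leqW.
  rewrite -lee_fin fineK ?fin_num_measure//.
  have -> : [set x | (level x < k)%N] = [set x : R | sigma * t k < `|x|].
    by apply/seteqP; split => x /=; rewrite level_lt.
  apply: le_trans (normal_two_sided_tail sigma (t k) s0) _; rewrite lee_fin.
  have /andP[? ?] := pv_bounds k kn.
  have : 1 - pv k <= Phi (t k) by apply: Phi_Phi_inv; apply/andP; split; lra.
  have : pv k = k%:R * alpha / n0%:R / 2 by [].
  lra.
have w0_ge0 l : 0 <= w0 l by exact: fine_ge0.
(* Cells are boxes in the coordinates, so their probabilities are exactly the product weights. *)
pose cell (k : {ffun 'I_n -> 'I_n0.+1}) : set T :=
  \bigcap_(i in [set: 'I_n]) (Z i @^-1` [set x | level x = k i]).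
have mcell k : measurable (cell k).
  apply: fin_bigcap_measurable => [|i _]; first exact: finite_finset.
  by rewrite -[X in measurable X]setTI; apply: mZ => //; exact: measurable_level_eq.
have Pcell k : P (cell k) = (\prod_i w0 (k i))%:E.
  rewrite ZE; last by move=> i; exact: measurable_level_eq.
  rewrite -prodEFin; apply: eq_bigr => i _; rewrite fineK//.
  by rewrite fin_num_measure//; exact: measurable_level_eq.
pose bad (k : {ffun 'I_n -> 'I_n0.+1}) := [exists u : 'I_#|N|.+1, simes_reject N k u].
have bad_le : \sum_(k : {ffun 'I_n -> 'I_n0.+1} | bad k) \prod_i w0 (k i) <= alpha.
  exact: (simes (fun=> w0) N alpha (fun=> w0_ge0)
  (fun=> level_weight_sum1 nu n0 level mlevel level_le) (ltW a0)
    (fun _ k _ => w0_tail k)).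
have sub : O `<=` \big[setU/set0]_(k : {ffun 'I_n -> 'I_n0.+1} | bad k) cell k.
  move=> w /OV[V [V0 VN]].
  have Vn : (V <= n0)%N.
    apply: leq_trans VN _.
    by apply: subset_leq_card; apply/fintype.subsetP => i; rewrite !inE => /andP[].
  pose k : {ffun 'I_n -> 'I_n0.+1} :=
    [ffun i => Ordinal (level_le (Z i w) : (_ < n0.+1)%N)].
  rewrite (bigD1 k)/=; first by left => i _ /=; rewrite ffunE.
  apply/existsP; exists (Ordinal (Vn : (V < n0.+1)%N)).
  rewrite /simes_reject V0/=; apply: leq_trans VN _.
  apply: subset_leq_card; apply/fintype.subsetP => i; rewrite !inE => /andP[-> /=].
  by rewrite ffunE/= level_lt// V0.
apply: le_trans (_ : _ <= P (\big[setU/set0]_(k | bad k) cell k))%E _.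
  by apply: le_measure => //; apply/mem_set; [|apply: bigsetU_measurable].
apply: le_trans (measure_bigsetU_le _ _ _ P _ _ _ _ _) _ => //.
rewrite (eq_bigr (fun k : {ffun 'I_n -> 'I_n0.+1} => (\prod_i w0 (k i))%:E));
  last by move=> k _; exact: Pcell.
by rewrite sumEFin lee_fin.
Qed.

(** The false discovery proportion depends on the sample only through the selected set, which takes
    finitely many values. *)
Lemma measurable_finite_pattern d (T : measurableType d) (I : finType)
    (B : I -> T -> bool) (Q : {set I} -> bool) :
  (forall i, measurable [set w | B i w]) ->
  measurable [set w | Q [set i | B i w]%SET].
Proof.
move=> mB.
pose cell (s : {set I}) := \bigcap_(i in [set: I]) [set w | B i w == (i \in s)].
have -> : [set w | Q [set i | B i w]%SET] = \bigcup_(s in [set s | Q s]) cell s.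
  apply/seteqP; split => w /=.
    by move=> Qw; exists [set i | B i w]%SET => // i _ /=; rewrite inE.
  move=> [s Qs ws]; rewrite (_ : [set i | B i w]%SET = s)//.
  by apply/setP => i; rewrite inE; have /eqP := ws i Logic.I.
apply: fin_bigcup_measurable => [|s _]; first exact: finite_finset.
apply: fin_bigcap_measurable => [|i _]; first exact: finite_finset.
case: (i \in s).
  by rewrite (_ : [set w | _] = [set w | B i w])//; apply/seteqP; split => w /= /eqP.
rewrite (_ : [set w | _] = ~` [set w | B i w]); first exact: measurableC.
by apply/seteqP; split => w /=; case: (B i w) => // /(_ isT).
Qed.

Theorem theorem5 (R : realType) (d : measure_display) (T : measurableType d)
  (P : probability T R) (n m : nat) (X : 'M[R]_(n, m)) (beta : 'cV[R]_m)
  (sigma alpha gamma : R) (eps : 'I_n -> T -> R) (bhat : T -> 'cV[R]_m) :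
  (m <= n)%N ->
  X^T *m X = 1%:M ->
  0 < sigma ->
  0 < alpha < 1 ->
  0 < gamma < 1 ->
  (forall j, measurable_fun [set: T] (eps j)) ->
  (forall j (B : set R), measurable B ->
     P (eps j @^-1` B) = normal_prob 0 sigma B) ->
  mutually_independent P eps ->
  (forall w (b : 'cV[R]_m),
     slope_obj X (X *m beta + \col_j eps j w) sigma (lambda_FDP m alpha gamma) (bhat w)
     <= slope_obj X (X *m beta + \col_j eps j w) sigma (lambda_FDP m alpha gamma) b) ->
  (P [set w | (gamma < FDP beta (bhat w))%R] <= alpha%:E)%E.
Proof.
move=> mn XX s0 alpha01 gamma01 meps epsN epsI bmin.
set lam := lambda_FDP m alpha gamma in bmin.
have lam_ni (i j : 'I_m) : (i <= j)%N -> lam j <= lam i by exact: lambda_FDP_ni.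
have lam_ge0 i : 0 <= lam i by exact: lambda_FDP_ge0.
pose y w : 'cV[R]_m := X^T *m (X *m beta + \col_j eps j w).
have yE w i : y w i 0 = beta i 0 + \sum_k X k i * eps k w.
  rewrite /y mulmxDr mulmxA XX mul1mx mxE; congr (_ + _).
  by rewrite mxE; apply: eq_bigr => k _; rewrite !mxE.
have my i : measurable_fun [set: T] (fun w => y w i 0).
  under eq_fun do rewrite yE.
  apply: measurable_funD => //; apply: measurable_sum => k.
  exact: measurable_funM.
have prox w b : prox_obj lam sigma (y w) (bhat w) <= prox_obj lam sigma (y w) b.
  have [K KE] := slope_obj_orthogonal R n m X (X *m beta + \col_j eps j w) sigma lam XX.
  by have := bmin w b; rewrite !KE lerD2l.
have msel i : measurable [set w | bhat w i 0 != 0].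
  apply: (measurable_open_preimage R d T m (fun j w => y w j 0)) => // w /= bi.
  have b0 : 0 < `|bhat w i 0| by rewrite normr_gt0.
  (* With this radius [4 * m * e ^+ 2] is [m / m.+1 ^+ 2] times the squared coordinate, too little
     for it to reach zero. *)
  exists (`|bhat w i 0| / (2 * m.+1%:R)); first by rewrite divr_gt0// mulr_gt0.
  move=> w' yw'; apply/eqP => b'i.
  have := prox_continuous lam lam_ni sigma s0 _ _ _ _ _ lam_ge0 (prox w) (prox w') yw' i.
  rewrite b'i subr0 leNgt => /negP; apply.
  rewrite exprMn real_normK ?num_real// exprVn exprMn -natrX.
  rewrite mulrCA gtr_pMr; last by rewrite exprn_even_gt0.
  rewrite ltr_pdivrMr ?mul1r; last by rewrite mulr_gt0// exprn_gt0.
  rewrite -natrM -natrX -natrM ltr_nat (ltn_mul2l 4)/= -mulnn.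
  exact: leq_pmulr.
have ZI : iid_normal P sigma eps.
  split=> // B mB; rewrite (epsI B mB).
  by apply: eq_bigr => k _; exact: epsN.
have Xon : orthonormal_rows m (fun a k => X k a).
  move=> a b; have := congr1 (fun M : 'M[R]_m => M a b) XX; rewrite !mxE => <-.
  by apply: eq_bigr => k _; rewrite mxE.
have [Z' ZI' ZE] := orthonormal_reduction P sigma (lt0r_neq0 s0) m _ eps mn Xon ZI.
pose N0 : {set 'I_m} := [set i | beta i 0 == 0]%SET.
pose N : {set 'I_n} := [set widen_ord mn i | i in N0]%SET.
have widen_inj : injective (widen_ord mn) by move=> i j /(congr1 val) /= /val_inj.
have N0card : #|N| = #|N0| by rewrite card_imset.
pose sel w : {set 'I_m} := [set i | bhat w i 0 != 0]%SET.
have selE w : num_selected (bhat w) = #|sel w|.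
  by rewrite num_selectedE; apply: eq_card => i; rewrite !inE.
have FDPE w : FDP beta (bhat w) = #|N0 :&: sel w|%:R / (maxn #|sel w| 1)%:R.
  by rewrite /FDP selE num_falseE; congr (_%:R / _); apply: eq_card => i; rewrite !inE.
apply: (simes_normal R d T P n sigma alpha Z' N) => //.
  under eq_set do rewrite FDPE.
  exact: (measurable_finite_pattern d T 'I_m (fun i w => bhat w i 0 != 0)
    (fun s => gamma < #|N0 :&: s|%:R / (maxn #|s| 1)%:R)).
move=> w /=; rewrite FDPE ltr_pdivlMr ?ltr0n ?leq_maxr// => gV.
set V := #|N0 :&: sel w| in gV *; have /andP[g0 _] := gamma01.
(* Positivity of [V] forces a selection, which removes the [maxn] guard. *)
have V0 : (0 < V)%N.
  by rewrite -(ltr0n R); apply: le_lt_trans gV; rewrite mulr_ge0// ltW.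
have Vs : (V <= #|sel w|)%N by apply: subset_leq_card; exact: subsetIr.
have Vn : (V <= #|N0|)%N by apply: subset_leq_card; exact: subsetIl.
have s1 : (0 < #|sel w|)%N by exact: leq_trans Vs.
rewrite (maxn_idPl s1) in gV.
have sm : (#|sel w|.-1 < m)%N.
  by rewrite prednK// -[leqRHS]card_ord max_card.
(* Ordinals start at 0, so the weight of index [#|sel w|] sits at its predecessor. *)
pose r := Ordinal sm; have rE : r.+1 = #|sel w| by rewrite /= prednK.
have lamV : Phi_inv (1 - V%:R * alpha / #|N|%:R / 2) <= lam r.
  apply: simes_le_lambda_FDP => //; rewrite ?rE// N0card ?V0//.
  (* Inclusion-exclusion: nulls and selected features together number at most [m], plus their
     overlap [V]. *)
  by rewrite -cardsUI leq_add2r -[leqRHS]card_ord max_card.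
exists V; split=> //.
rewrite -[leqLHS](card_imset _ widen_inj).
apply: subset_leq_card; apply/fintype.subsetP => _ /imsetP[a aV ->].
move: aV; rewrite !inE => /andP[/eqP ba ab].
have aN : widen_ord mn a \in N by apply/imsetP; exists a; rewrite // inE; apply/eqP.
rewrite aN /=.
apply: le_lt_trans (_ : _ <= sigma * lam r) _; first by rewrite ler_pM2l.
have -> : `|Z' (widen_ord mn a) w| = `|y w a 0| by rewrite -ZE yE ba add0r.
by apply: prox_selected (prox w) ab _ => //; rewrite selE rE.
Qed.
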